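(* Let $t \in [n]$. The set of prime ideals of $R$ minimal over $\mathcal{I}^{\langle t\rangle}$ equals the set of ideals of the form $P^{\langle t\rangle}_S$ as $S$ varies over the maximal $t$-switchable subsets of $N$.
   Context: Fix positive integers $n, r_1,\dots,r_n$, let $N=[r_1]\times\cdots\times[r_n]$ (where $[r]=\{1,\dots,r\}$), and let $R$ be the polynomial ring over a field in the variables $x_a$, $a\in N$. For $L\subseteq[n]$ and $a,b\in N$, the switch ${\rm s}(L,a,b)\in N$ has $i$-th component $b_i$ if $i\in L$ and $a_i$ otherwise; write ${\rm s}(i,a,b)={\rm s}(\{i\},a,b)$. Let $d(a,b)=\#\{i: a_i\neq b_i\}$. Set $f_{i,a,b}=x_ax_b-x_{{\rm s}(i,a,b)}x_{{\rm s}(i,b,a)}$. For $t\in[n]$, $\mathcal{I}^{\langle t\rangle}=(f_{i,a,b}: a,b\in N,\ d(a,b)=2,\ i\in[t])$. A subset $S\subseteq N$ is $t$-switchable if for all $a,b\in S$ with $d(a,b)=2$ and all $i\in[t]$, ${\rm s}(i,a,b)\in S$. Elements $a,b\in S$ are connected in $S$ if there are $a_0=a,a_1,\dots,a_k=b$ in $S$ with $d(a_{j-1},a_j)\le 1$ for all $j$. For a $t$-switchable $S$, set $\tilde{\mathcal{I}}^{\langle t\rangle}_S=(f_{i,a,b}: i\in[t],\ a,b \text{ connected in } S)$, $\mathrm{Var}^{\langle t\rangle}_S=(x_a: a\notin S)$, and $P^{\langle t\rangle}_S=\mathrm{Var}^{\langle t\rangle}_S+\tilde{\mathcal{I}}^{\langle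 t\rangle}_S$. A $t$-switchable $S$ is maximal $t$-switchable if for every $t$-switchable $T\subseteq N$ properly containing $S$, the ideals $P^{\langle t\rangle}_S$ and $P^{\langle t\rangle}_T$ are incomparable under inclusion. *)

(* Defs.v *)
From HB Require Import structures.
From mathcomp Require Import all_boot all_algebra.
From mathcomp Require Import mpoly.
Set Implicit Arguments. Unset Strict Implicit. Unset Printing Implicit Defensive.
Import GRing.Theory.
Local Open Scope ring_scope.

(* Conventions: [n] = 'I_n (0-based), [r_i] = 'I_(r i) (0-based).
   N = product of the [r_i], as a dependent finite function type. *)
Definition Nset (n : nat) (r : 'I_n -> nat) : finType :=
  {dffun forall i : 'I_n, 'I_(r i)}.

Section Defs.
Variables (n : nat) (r : 'I_n -> nat) (F : fieldType).

Local Notation N := (Nset r).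
Local Notation R := {mpoly F[#|N|]}.

Definition xvar (a : N) : R := 'X_(enum_rank a).

Definition switch (i : 'I_n) (a b : N) : N :=
  [ffun j => if j == i then b j else a j].

Definition dist (a b : N) : nat := #|[set i | a i != b i]|.

Definition fgen (i : 'I_n) (a b : N) : R :=
  xvar a * xvar b - xvar (switch i a b) * xvar (switch i b a).

Definition pset := R -> Prop.
Definition psubset (I J : pset) : Prop := forall p, I p -> J p.

Definition is_ideal (I : pset) : Prop :=
  [/\ I 0, (forall p q, I p -> I q -> I (p + q)) &
      (forall p q, I q -> I (p * q))].

Definition ideal_gen (G : pset) : pset :=
  fun p => forall I, is_ideal I -> psubset G I -> I p.

Definition ideal_add (I J : pset) : pset :=
  fun p => exists x y, [/\ I x, J y & p = x + y].

Definition prime_ideal (P : pset) : Prop :=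
  [/\ is_ideal P, ~ P 1 & forall a b, P (a * b) -> P a \/ P b].

Definition minimal_prime_over (J P : pset) : Prop :=
  [/\ prime_ideal P, psubset J P &
      forall Q, prime_ideal Q -> psubset J Q -> psubset Q P -> psubset P Q].

(* I^<t> ; i in [t] means (0-based) i < t *)
Definition Iideal (t : nat) : pset :=
  ideal_gen (fun p => exists (i : 'I_n) (a b : N),
                [/\ dist a b = 2, (i < t)%N & p = fgen i a b]).

Definition switchable (t : nat) (S : {set N}) : Prop :=
  forall a b, a \in S -> b \in S -> dist a b = 2 ->
  forall i : 'I_n, (i < t)%N -> switch i a b \in S.

Definition connected_in (S : {set N}) (a b : N) : bool :=
  [&& a \in S, b \in S &
      connect [rel x y | [&& x \in S, y \in S & (dist x y <= 1)%N]] a b].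

Definition Itilde (t : nat) (S : {set N}) : pset :=
  ideal_gen (fun p => exists (i : 'I_n) (a b : N),
                [/\ (i < t)%N, connected_in S a b & p = fgen i a b]).

Definition VarS (S : {set N}) : pset :=
  ideal_gen (fun p => exists a : N, a \notin S /\ p = xvar a).

Definition PS (t : nat) (S : {set N}) : pset :=
  ideal_add (VarS S) (Itilde t S).

Definition maximal_switchable (t : nat) (S : {set N}) : Prop :=
  switchable t S /\
  forall T : {set N}, switchable t T -> S \proper T ->
    ~ psubset (PS t S) (PS t T) /\ ~ psubset (PS t T) (PS t S).

End Defs.

(* Main.v *)
Require Import Defs.
From HB Require Import structures.
From Stdlib Require Import Classical.
From mathcomp Require Import all_boot all_algebra ring.
From mathcomp Require Import mpoly.
Set Implicit Arguments. Unset Strict Implicit. Unset Printing Implicit Defensive.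
Import GRing.Theory.
Local Open Scope ring_scope.

(* Each [PS t S] with [S] t-switchable is the kernel of a toric map, hence
   prime: a variable outside [S] goes to 0, and [x_a] with [a] in [S] goes to
   a monomial recording the connected component of [a], each single coordinate
   of [a], and the tuple of its coordinates of index at least [t]. Two products
   of variables with the same image differ by switches inside a component, so
   the kernel is generated by the obvious elements.
   Conversely, let [P] be a prime containing [Iideal t] and [S] the set of
   the [a] with [x_a] not in [P]. Along an edge of [S] the vectors
   [(x_(switch i a e))_e] stay proportional modulo [P], so [P] contains every
   [fgen i a b] with [a], [b] connected in [S], that is [PS t S]. The minimal
   primes are thus the minimal ideals among the [PS t S]; as [PS t T] contained
   in [PS t S] forces [S] to be a subset of [T], these are the ideals of the
   maximal t-switchable sets. *)

(** * Kernels of linear maps that send each monomial to a monomial or to 0 *)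

Lemma mpolyX_neq0 (k : nat) (F : fieldType) (m : 'X_{1.. k}) : 'X_[m] != 0 :> {mpoly F[k]}.
Proof. by rewrite -msupp_eq0 msuppX. Qed.

(* A monomial of [p] with nonzero image shares this image with another monomial
   of [p], since the images cancel; their difference is subtracted off. *)
Lemma monomial_kernel (n k : nat) (F : fieldType)
    (phi : {linear {mpoly F[n]} -> {mpoly F[k]}}) (J : {mpoly F[n]} -> Prop) :
  J 0 -> (forall p q, J p -> J q -> J (p + q)) ->
  (forall c p, J p -> J (c *: p)) ->
  (forall m, phi 'X_[m] = 0 \/ exists w, phi 'X_[m] = 'X_[w]) ->
  (forall m, phi 'X_[m] = 0 -> J 'X_[m]) ->
  (forall m m', phi 'X_[m] = phi 'X_[m'] -> J ('X_[m] - 'X_[m'])) ->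
  forall p, phi p = 0 -> J p.
Proof.
move=> J0 JD JZ phiX JX JB p.
have [s] := ubnP (size (msupp p)); elim: s p => // s IHs p le_ps phip0.
case E: (msupp p) => [|m0 e].
  by move/eqP: E; rewrite msupp_eq0 => /eqP ->.
have m0p : m0 \in msupp p by rewrite E mem_head.
(* Subtracting a multiple of [q] that kills [m0] and creates no new monomial shrinks the support, so
   induction applies. *)
have cut q : phi q = 0 -> J q -> {subset msupp (p - p@_m0 *: q) <= msupp p} ->
    m0 \notin msupp (p - p@_m0 *: q) -> J p.
  move=> phiq0 Jq sub m0N; rewrite -[p](subrK (p@_m0 *: q)).
  apply: JD (JZ _ _ Jq); apply: IHs; last first.
    by rewrite linearB linearZ /= phip0 phiq0 scaler0 subr0.
  apply: (@leq_trans (size (rem m0 (msupp p))).+1); last first.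
    by rewrite size_rem // prednK // E.
  rewrite ltnS.
  apply: uniq_leq_size => // m m_in; rewrite mem_rem_uniq //= inE sub // andbT.
  by apply/eqP => mm0; rewrite mm0 (negPf m0N) in m_in.
case: (phiX m0) => [phi0|[w phiw]].
  apply: (cut 'X_[m0]) => //; first exact: JX.
    by move=> m; rewrite (perm_mem (msupp_rem p m0)) => /mem_rem.
  by rewrite (perm_mem (msupp_rem p m0)) mem_rem_uniq // inE eqxx.
have [|] := boolP (has (fun m => (m != m0) && (phi 'X_[m] == 'X_[w])) (msupp p)).
  case/hasP=> m1 m1p /andP[ne10 /eqP phi1].
  apply: (cut ('X_[m0] - 'X_[m1])).
  - by rewrite linearB /= phiw phi1 subrr.
  - by apply: JB; rewrite phiw phi1.
  - move=> m; apply: contraLR => mNp.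
    have coef0 m' : m' \in msupp p -> ('X_[m'] : {mpoly F[n]})@_m = 0.
      rewrite mcoeffX => m'p; case: eqP => // mm'.
      by rewrite -mm' m'p in mNp.
    rewrite mcoeff_msupp mcoeffB mcoeffZ mcoeffB (memN_msupp_eq0 mNp).
    by rewrite !coef0 // !(subrr, mulr0) eqxx.
  - rewrite mcoeff_msupp mcoeffB mcoeffZ mcoeffB !mcoeffX eqxx (negPf ne10).
    by rewrite subr0 mulr1 subrr eqxx.
(* No other monomial of [p] maps to ['X_[w]], so the coefficient of [w] in [phi p] is that of [m0]
   in [p], which is nonzero. *)
move=> /hasPn none; move: (m0p); rewrite mcoeff_msupp => /eqP; case.
have: (phi p)@_w = 0 by rewrite phip0 mcoeff0.
rewrite [p in phi p]mpolyE linear_sum /= raddf_sum /= (bigD1_seq m0) //=.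
rewrite linearZ /= mcoeffZ phiw mcoeffX eqxx mulr1 big_seq_cond big1 ?addr0; first by move->.
move=> m /andP[mp nem]; rewrite linearZ /= mcoeffZ.
have := none m mp; rewrite nem /=.
case: (phiX m) => [->|[w' ->]]; first by rewrite mcoeff0 mulr0.
rewrite mcoeffX; have [->|_] := eqVneq w' w; first by rewrite eqxx.
by rewrite mulr0.
Qed.

(** * Switches, Hamming distance and connected components *)

Section Switches.
Variables (n : nat) (r : 'I_n -> nat).
Local Notation N := (Nset r).
Implicit Types (i j : 'I_n) (a b c d e : N) (S T : {set N}).

Lemma switchE i a b j : switch i a b j = if j == i then b j else a j.
Proof. by rewrite ffunE. Qed.

Lemma switch_eq i a b : a i = b i -> switch i a b = a.
Proof. by move=> ab; apply/ffunP=> j; rewrite switchE; case: eqP => // ->. Qed.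

Lemma switchxx i a : switch i a a = a.
Proof. exact: switch_eq. Qed.

Lemma switch_switchr i a b c : switch i a (switch i b c) = switch i a c.
Proof. by apply/ffunP=> j; rewrite !switchE; case: eqP. Qed.

Lemma switch_switchl i a b c : switch i (switch i a b) c = switch i a c.
Proof. by apply/ffunP=> j; rewrite !switchE; case: eqP. Qed.

Lemma dist_sym a b : dist a b = dist b a.
Proof. by apply: eq_card => j; rewrite !inE eq_sym. Qed.

Lemma dist0P a b : reflect (a = b) (dist a b == 0%N).
Proof.
rewrite cards_eq0; apply: (iffP eqP) => [ab|->]; last first.
  by apply/setP => j; rewrite !inE eqxx.
apply/ffunP=> j; apply/eqP; apply/negPn.
by move/setP: ab => /(_ j); rewrite !inE => ->.
Qed.

Lemma dist_switchl i a b : (dist a (switch i a b) <= 1)%N.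
Proof.
rewrite -(cards1 i); apply: subset_leq_card; apply/subsetP => j.
by rewrite !inE switchE; case: (eqVneq j i); rewrite ?eqxx.
Qed.

Lemma dist_switchr i a b : a i != b i -> (dist a b = (dist (switch i a b) b).+1)%N.
Proof.
move=> ab; rewrite /dist (cardsD1 i) inE ab; congr _.+1.
apply: eq_card => j; rewrite !inE switchE.
by case: (j == i); rewrite ?eqxx.
Qed.

(** The endpoints of an edge that differ at [i] agree everywhere else, and a switch at [i]
    overwrites that one difference. *)
Lemma edge_switch i a b e : (dist a b <= 1)%N -> a i != b i ->
  switch i a e = switch i b e.
Proof.
move=> ab1 ab; apply/ffunP => j; rewrite !switchE; case: (eqVneq j i) => // ji.
move: ab1; rewrite (dist_switchr ab) ltnS leqn0 => /dist0P /ffunP/(_ j).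
by rewrite switchE (negPf ji).
Qed.

Lemma edge_dist2 i a b e : (dist a b <= 1)%N -> a != b -> a i = b i -> e i != a i ->
  dist a (switch i b e) = 2.
Proof.
move=> ab1 ab abi ei; have d1: dist a b = 1%N.
  by move: ab1 (introN (dist0P a b) (elimN eqP ab)); case: (dist a b) => [|[]].
have ai : switch i b e i != a i by rewrite switchE eqxx.
rewrite dist_sym (dist_switchr ai) dist_sym.
by rewrite switch_switchl (switch_eq (esym abi)) d1.
Qed.

Definition edge S : rel N := [rel x y | [&& x \in S, y \in S & (dist x y <= 1)%N]].

Lemma connected_ind S a (Q : N -> Prop) :
  (forall c d, c \in S -> d \in S -> (dist c d <= 1)%N -> Q c -> Q d) ->
  forall b, connected_in S a b -> Q a -> Q b.
Proof.
move=> QS b /and3P[_ _ /connectP[p]].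
elim: p a => [|c p IHp] a /=; first by move=> _ ->.
case/andP=> /and3P[aS cS ac] cp eb /(QS _ _ aS cS ac); exact: IHp.
Qed.

Lemma connected_inl S a b : connected_in S a b -> a \in S.
Proof. by case/and3P. Qed.

Lemma connected_inr S a b : connected_in S a b -> b \in S.
Proof. by case/and3P. Qed.

Lemma connected_refl S a : a \in S -> connected_in S a a.
Proof. by move=> aS; rewrite /connected_in aS connect0. Qed.

Lemma connected_sym S a b : connected_in S a b = connected_in S b a.
Proof.
rewrite /connected_in [connect _ a b](_ : _ = connect (edge S) b a) 1?andbCA //.
by apply: sym_connect_sym => x y /=; rewrite andbCA dist_sym.
Qed.

Lemma connected_trans S b a c :
  connected_in S a b -> connected_in S b c -> connected_in S a c.
Proof.
case/and3P=> aS _ ab /and3P[_ cS bc].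
by rewrite /connected_in aS cS; apply: connect_trans bc.
Qed.

Lemma connected_edge S a b : a \in S -> b \in S -> (dist a b <= 1)%N ->
  connected_in S a b.
Proof.
by move=> aS bS ab; rewrite /connected_in aS bS connect1 //= aS bS ab.
Qed.

(** Coordinate values at [i] travel along paths: across an edge [c], [d] with [c i = d i], the
    points [c] and [switch i d e] are at distance 2, and switching them at [i] puts [switch i c e]
    in [S]. Starting from [b] itself, this reaches [switch i a b]. *)
Lemma connected_switch t S i a b : switchable t S -> (i < t)%N ->
  connected_in S a b -> connected_in S a (switch i a b).
Proof.
move=> swS it ab; have aS := connected_inl ab.
suff: switch i a b \in S by move=> ?; apply: connected_edge; rewrite ?dist_switchl.
suff: forall e, switch i b e \in S -> switch i a e \in S.
  by apply; rewrite switchxx (connected_inr ab).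
apply: (connected_ind (Q := fun c => forall e, switch i c e \in S -> switch i a e \in S)) ab _ => //.
move=> c d cS dS cd IH e deS; apply: IH.
have [cdi|cdi] := eqVneq (c i) (d i); last by rewrite (edge_switch _ cd cdi).
have [eci|eci] := eqVneq (e i) (c i); first by rewrite switch_eq.
have [->//|ne_cd] := eqVneq c d.
have := swS _ _ cS deS (edge_dist2 cd ne_cd cdi eci) i it.
by rewrite switch_switchr.
Qed.

(** The switch of [a] at [i] lies in [S] and is at distance at most 1 from both points. *)
Lemma connected_dist2 t S i a b : switchable t S -> (i < t)%N ->
  a i != b i -> dist a b = 2 -> a \in S -> b \in S -> connected_in S a b.
Proof.
move=> swS it abi d2 aS bS; have abS := swS _ _ aS bS d2 _ it.
apply: (@connected_trans _ (switch i a b)).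
  by apply: connected_edge; rewrite ?dist_switchl.
by apply: connected_edge => //; rewrite -ltnS -(dist_switchr abi) d2.
Qed.

End Switches.

(** * Generated ideals and the universal property of [PS] *)

Section Ideals.
Variables (n : nat) (r : 'I_n -> nat) (F : fieldType).
Local Notation N := (Nset r).
Local Notation R := {mpoly F[#|N|]}.
Implicit Types (I J G : pset r F) (p q : R).

Lemma idealN I p : is_ideal I -> I p -> I (- p).
Proof. by case=> _ _ IM Ip; rewrite -mulN1r; apply: IM. Qed.

Lemma idealB I p q : is_ideal I -> I p -> I q -> I (p - q).
Proof. by move=> idI Ip /(idealN idI); case: idI => _ ID _; apply: ID. Qed.

Lemma ideal_gen_ideal G : is_ideal (ideal_gen G).
Proof.
split=> [I [] //|p q Gp Gq I idI GI|p q Gq I idI GI]; case: (idI) => _ ID IM.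
  by apply: ID; [apply: Gp|apply: Gq].
by apply: IM; apply: Gq.
Qed.

Lemma ideal_add_ideal I J : is_ideal I -> is_ideal J -> is_ideal (ideal_add I J).
Proof.
move=> [I0 ID IM] [J0 JD JM]; split.
- by exists 0, 0; rewrite addr0.
- move=> _ _ [x [y [Ix Jy ->]]] [x' [y' [Ix' Jy' ->]]].
  by exists (x + x'), (y + y'); split; [exact: ID|exact: JD|rewrite addrACA].
- move=> p _ [x [y [Ix Jy ->]]].
  by exists (p * x), (p * y); split; [exact: IM|exact: JM|rewrite mulrDr].
Qed.

Lemma PS_ideal t (S : {set N}) : is_ideal (PS (F:=F) t S).
Proof. by apply: ideal_add_ideal; apply: ideal_gen_ideal. Qed.

Lemma PS_xvar t (S : {set N}) a : a \notin S -> PS t S (xvar F a).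
Proof.
move=> aS; exists (xvar F a), 0; rewrite addr0; split => //.
  by move=> I _; apply; exists a.
by case: (@ideal_gen_ideal (fun p => exists (i : 'I_n) (a b : N),
  [/\ (i < t)%N, connected_in S a b & p = fgen F i a b])).
Qed.

Lemma PS_fgen t (S : {set N}) (i : 'I_n) a b :
  (i < t)%N -> connected_in S a b -> PS t S (fgen F i a b).
Proof.
move=> it ab; exists 0, (fgen F i a b); rewrite add0r; split => //.
  by case: (@ideal_gen_ideal (fun p => exists a : N, a \notin S /\ p = xvar F a)).
by move=> I _; apply; exists i, a, b.
Qed.

Lemma PS_min t (S : {set N}) I : is_ideal I ->
  (forall a, a \notin S -> I (xvar F a)) ->
  (forall (i : 'I_n) a b, (i < t)%N -> connected_in S a b -> I (fgen F i a b)) ->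
  psubset (PS t S) I.
Proof.
move=> idI Ivar If p [x [y [Vx Jy ->]]]; case: (idI) => _ ID _; apply: ID.
  by apply: Vx => // _ [a [aS ->]]; apply: Ivar.
by apply: Jy => // _ [i [a [b [it ab ->]]]]; apply: If.
Qed.

End Ideals.

(** * [PS t S] as the kernel of a toric map *)

Section ToricMap.
Variables (n : nat) (r : 'I_n -> nat) (F : fieldType) (t : nat).
Local Notation N := (Nset r).
Local Notation R := {mpoly F[#|N|]}.
Variable S : {set N}.
Hypothesis swS : switchable t S.
Local Notation x := (xvar F).
Implicit Types (i j : 'I_n) (a b c w : N) (s : seq N).

Local Notation K := (option 'I_n * N)%type.

(* The values of the block [k.1] of coordinates, and the component, are encoded
   by any element [k.2] that shares them. A singleton block [{j}] with [t <= j]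
   is redundant but harmless: no switch at an index below [t] changes it. *)
Definition has_key (k : K) (a : N) : bool :=
  connected_in S k.2 a &&
  (if k.1 is Some i then k.2 i == a i
   else [forall j : 'I_n, (t <= j)%N ==> (k.2 j == a j)]).

Definition weight (a : N) : 'X_{1.. #|{: K}|} :=
  [multinom (has_key (enum_val k) a : nat) | k < #|{: K}|].

Definition toric_images : #|N|.-tuple {mpoly F[#|{: K}|]} :=
  [tuple if enum_val k \in S then 'X_[weight (enum_val k)] else 0 | k < #|N|].

Local Notation toric_map := (comp_mpoly toric_images).

Lemma toric_map_xvar a : toric_map (x a) = if a \in S then 'X_[weight a] else 0.
Proof. by rewrite comp_mpolyXU -tnth_nth tnth_mktuple enum_rankK. Qed.

Lemma toric_map_prod s : toric_map (\prod_(a <- s) x a) =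
  if all (mem S) s then 'X_[(\sum_(a <- s) weight a)%MM] else 0.
Proof.
rewrite rmorph_prod /=; elim: s => [|a s IHs] /=.
  by rewrite !big_nil mpolyX0.
rewrite !big_cons IHs toric_map_xvar.
by case: (a \in S) => /=; case: (all _ s); rewrite ?mulr0 ?mul0r // mpolyXD.
Qed.

Lemma weightE a k : weight a (enum_rank k) = has_key k a.
Proof. by rewrite mnmE enum_rankK. Qed.

(** The switch stays in the component, exchanges the two values at [i], and leaves the coordinates
    of index at least [t] alone, so every key is counted equally often on both sides. *)
Lemma weight_switch i a b : (i < t)%N -> connected_in S a b ->
  (weight a + weight b)%MM = (weight (switch i a b) + weight (switch i b a))%MM.
Proof.
move=> it ab; have ba : connected_in S b a by rewrite connected_sym.
have eq_conn w c d : connected_in S c d -> connected_in S w c = connected_in S w d.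
  move=> cd; apply/idP/idP => [wc|wd]; first exact: connected_trans cd.
  by apply: connected_trans wd _; rewrite connected_sym.
apply/mnmP => k; rewrite !mnmDE -(enum_valK k) !weightE /has_key.
move: (enum_val k) => [o w] /=.
rewrite -(eq_conn w _ _ (connected_switch swS it ba)) (eq_conn w _ _ ba).
rewrite -(eq_conn w _ _ (connected_switch swS it ab)).
case: (connected_in S w a) => //=; case: o => [j|].
  by rewrite !switchE; case: (j == i); rewrite // addnC.
congr (nat_of_bool _ + nat_of_bool _)%N; apply: eq_forallb => j; rewrite switchE;
  by case: (eqVneq j i) => // ->; rewrite leqNgt it.
Qed.

Lemma weight_has_key k s b m :
  (\sum_(a <- s) weight a = weight b + m)%MM -> has_key k b ->
  exists2 a, a \in s & has_key k a.
Proof.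
move=> /mnmP/(_ (enum_rank k)) sbm kb; apply/hasP; apply/negPn/negP => /hasPn nk.
move: sbm; rewrite mnmDE mnm_sumE weightE kb big_seq big1 // => a /nk.
by rewrite weightE => /negPf ->.
Qed.

(* While [a] differs from [b] at some [i], which must be below [t], equality of
   weights provides a [c] in [s] with [c i = b i]; switching [a] and [c] at [i]
   brings [a] closer to [b]. *)
Lemma extract_factor d s a b m : (dist a b <= d)%N -> all (mem S) s -> a \in s ->
  connected_in S a b -> (forall j, (t <= j)%N -> a j = b j) ->
  (\sum_(c <- s) weight c = weight b + m)%MM ->
  exists s', [/\ all (mem S) s', (\sum_(c <- s') weight c)%MM = m &
    PS t S (\prod_(c <- s) x c - x b * \prod_(c <- s') x c)].
Proof.
have idP := PS_ideal F t S; have [P0 PD PM] := idP.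
elim: d s a => [|d IHd] s a ab_d Ss a_s ab tail sbm;
    (have [eab|nab] := eqVneq a b; [|
     have ab0 : dist a b != 0%N by apply: contraNneq nab => /eqP/dist0P ->]);
  try by rewrite leqn0 (negPf ab0) in ab_d.
(* When [a = b], in the base case and in the inductive step alike, [b] is already a factor and is
   simply removed. *)
1,2: subst b; exists (rem a s); split;
  [ by apply/allP => c /mem_rem; apply/allP
  | by move: sbm; rewrite (perm_big _ (perm_to_rem a_s)) big_cons /= => /addmI
  | by rewrite (perm_big _ (perm_to_rem a_s)) /= big_cons subrr ].
have [i abi] : exists i, a i != b i.
  by move: ab0; rewrite cards_eq0 => /set0Pn[i]; rewrite inE; exists i.
have it : (i < t)%N by rewrite ltnNge; apply: contraNN abi => /tail ->.
have bb : has_key (Some i, b) b.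
  by rewrite /has_key /= eqxx connected_refl // (connected_inr ab).
have [c cs /andP[/= bc /eqP bci]] := weight_has_key sbm bb.
have ac := connected_trans ab bc.
have ps : perm_eq s [:: a, c & rem c (rem a s)].
  apply: perm_trans (perm_to_rem a_s) _; rewrite perm_cons; apply: perm_to_rem.
  have : c \in a :: rem a s by rewrite -(perm_mem (perm_to_rem a_s)).
  by rewrite inE => /orP[/eqP ca|//]; rewrite bci ca eqxx in abi.
move: ps; set s2 := rem c _ => ps.
have swac : switch i a c = switch i a b.
  by apply/ffunP => j; rewrite !switchE; case: eqP => // ->.
pose s3 := [:: switch i a c, switch i c a & s2].
have Wss3 : (\sum_(e <- s) weight e = \sum_(e <- s3) weight e)%MM.
  by rewrite (perm_big _ ps) /= !big_cons !addmA (weight_switch it ac).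
have ca : connected_in S c a by rewrite connected_sym.
have ac' := connected_switch swS it ac.
have [s' [Ss' Ws' Ps']] : exists s', [/\ all (mem S) s',
    (\sum_(e <- s') weight e)%MM = m &
    PS t S (\prod_(e <- s3) x e - x b * \prod_(e <- s') x e)].
  apply: (IHd s3 (switch i a c)) => //.
  - by rewrite swac -ltnS -(dist_switchr abi).
  - rewrite /= (connected_inr ac') (connected_inr (connected_switch swS it ca)) /=.
    by move: Ss; rewrite (perm_all _ ps) /= => /and3P[].
  - by rewrite inE eqxx.
  - by apply: connected_trans ab; rewrite connected_sym.
  - move=> j tj; rewrite switchE; case: eqP => [ji|_]; last exact: tail.
    by rewrite ji leqNgt it in tj.
  - by rewrite -Wss3.
exists s'; split => //.
(* Replacing [a], [c] by their switches changes the product by a multiple of a generator of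
   [PS t S]. *)
have -> : \prod_(e <- s) x e = \prod_(e <- s2) x e * fgen F i a c + \prod_(e <- s3) x e.
  rewrite (perm_big _ ps) /= !big_cons /fgen; ring.
by rewrite -addrA; apply: PD Ps'; apply: PM; apply: PS_fgen.
Qed.

(** The factors of [s'] are peeled off one by one: the key [(None, b)] yields an element of [s] in
    the component of [b] with the same tail, the starting point that [extract_factor] needs. The
    same key shows that no nonempty list has weight 0. *)
Lemma PS_weight_eq s s' : all (mem S) s -> all (mem S) s' ->
  (\sum_(a <- s) weight a = \sum_(a <- s') weight a)%MM ->
  PS t S (\prod_(a <- s) x a - \prod_(a <- s') x a).
Proof.
have [P0 PD PM] := PS_ideal F t S.
have tailkey b : b \in S -> has_key (None, b) b.
  by move=> bS; rewrite /has_key /= connected_refl //; apply/forall_inP.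
elim: s' s => [|b s' IHs] s.
  case: s => [|a s]; first by rewrite subrr.
  rewrite big_cons => /andP[aS _] _ /esym W.
  by have [] := weight_has_key W (tailkey a aS).
move=> Ss /andP[bS Ss']; rewrite !big_cons => W.
have [a a_s /andP[/= ba /forall_inP tl]] := weight_has_key W (tailkey b bS).
have ab : connected_in S a b by rewrite connected_sym.
have tail j : (t <= j)%N -> a j = b j by move=> /tl /eqP.
have [s1 [Ss1 W1 P1]] := extract_factor (leqnn _) Ss a_s ab tail W.
have := PD _ _ P1 (PM (x b) _ (IHs s1 Ss1 Ss' W1)).
by rewrite mulrBr addrA subrK.
Qed.

Lemma monomial_prod (m : 'X_{1.. #|N|}) :
  exists s, 'X_[m] = \prod_(a <- s) x a :> R.
Proof.
rewrite mpolyXE_id; 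
apply: (big_ind (fun p : R => exists s, p = \prod_(a <- s) x a)) => [|p q [s ->] [s' ->]|k _].
- by exists [::]; rewrite big_nil.
- by exists (s ++ s'); rewrite big_cat.
- by exists (nseq (m k) (enum_val k)); rewrite big_nseq /xvar enum_valK iter_mulr_1.
Qed.

Lemma PS_prod s : ~~ all (mem S) s -> PS t S (\prod_(a <- s) x a).
Proof.
case/allPn=> a a_s aS; rewrite (perm_big _ (perm_to_rem a_s)) /= big_cons mulrC.
by have [_ _ PM] := PS_ideal F t S; apply: PM; apply: PS_xvar.
Qed.

Lemma PS_ker p : PS t S p <-> toric_map p = 0.
Proof.
split=> [|].
  apply: (PS_min (I := fun q => toric_map q = 0)) => [|a /negPf aS|i a b it ab].
  - split=> [|p1 p2|p1 p2]; first exact: rmorph0.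
      by rewrite rmorphD /= => -> ->; rewrite addr0.
    by rewrite rmorphM /= => ->; rewrite mulr0.
  - by rewrite toric_map_xvar aS.
  - have ba : connected_in S b a by rewrite connected_sym.
    have abS := connected_inr (connected_switch swS it ab).
    have baS := connected_inr (connected_switch swS it ba).
    rewrite /fgen rmorphB !rmorphM /= !toric_map_xvar.
    rewrite (connected_inl ab) (connected_inr ab) abS baS -!mpolyXD.
    by rewrite (weight_switch it ab) subrr.
have [P0 PD PM] := PS_ideal F t S.
apply: (@monomial_kernel _ _ F (comp_mpoly toric_images)) => //.
- by move=> c q Pq; rewrite -mul_mpolyC; apply: PM.
- move=> m /=; have [s ->] := monomial_prod m; rewrite toric_map_prod.
  by case: ifP => _; [right; eexists|left].
- move=> m /=; have [s ->] := monomial_prod m; rewrite toric_map_prod.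
  by case: ifP => [_ /eqP|/negbT/PS_prod//]; rewrite (negPf (mpolyX_neq0 _ _)).
- move=> m m' /=; have [s ->] := monomial_prod m; have [s' ->] := monomial_prod m'.
  rewrite !toric_map_prod.
  case: ifP => [Ss|/negbT/PS_prod Ps]; case: ifP => [Ss'|/negbT/PS_prod Ps'].
  (* Comparing coefficients at the weight of [s] forces the two weights to agree. *)
  - move=> /mpolyP/(_ (\sum_(a <- s) weight a)%MM).
    rewrite !mcoeffX eqxx; case: eqP => [/esym W _|_ /eqP]; first exact: PS_weight_eq.
    by rewrite oner_eq0.
  - by move=> /eqP; rewrite (negPf (mpolyX_neq0 _ _)).
  - by move=> /esym/eqP; rewrite (negPf (mpolyX_neq0 _ _)).
  - by move=> _; apply: idealB => //; apply: PS_ideal.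
Qed.

Lemma PS_prime : prime_ideal (PS (F := F) t S).
Proof.
split=> [||p q]; first exact: PS_ideal.
  by rewrite PS_ker  rmorph1 => /eqP; rewrite oner_eq0.
by rewrite !PS_ker  rmorphM => /eqP; rewrite mulf_eq0 => /orP[]/eqP; auto.
Qed.

Lemma PS_xvarE a : PS t S (x a) <-> a \notin S.
Proof.
split=> [|/PS_xvar//]; rewrite PS_ker toric_map_xvar; case: ifP => // _ /eqP.
by rewrite (negPf (mpolyX_neq0 _ _)).
Qed.

End ToricMap.

(** * Primes over [Iideal t] and the sets they determine *)

Section Minimal.
Variables (n : nat) (r : 'I_n -> nat) (F : fieldType) (t : nat).
Local Notation N := (Nset r).
Local Notation R := {mpoly F[#|N|]}.
Local Notation x := (xvar F).
Implicit Types (i j : 'I_n) (a b c d e : N) (S T : {set N}) (P : pset r F).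

Lemma fgen_switch i a b c : a i = b i ->
  fgen F i b (switch i a c) = x b * x (switch i a c) - x a * x (switch i b c).
Proof.
move=> ab; rewrite /fgen switch_switchr switch_switchl (switch_eq ab).
by rewrite [x a * _]mulrC.
Qed.

Lemma Iideal_PS S : switchable t S -> psubset (Iideal (F := F) t) (PS t S).
Proof.
move=> swS p Ip; have idP := PS_ideal F t S; have [P0 PD PM] := idP.
apply: Ip => // _ [i [a [b [d2 it ->]]]].
have [abi|abi] := eqVneq (a i) (b i).
  rewrite /fgen (switch_eq abi) (switch_eq (esym abi)) subrr; exact: P0.
have [/andP[aS bS]|abS] := boolP ((a \in S) && (b \in S)).
  by apply: PS_fgen => //; exact: (connected_dist2 swS it abi d2 aS bS).
have mulS c d : ~~ ((c \in S) && (d \in S)) -> PS t S (x c * x d).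
  rewrite negb_and => /orP[] /PS_xvar-/(_ F t) Pc; last exact: PM.
  by rewrite mulrC; apply: PM.
(* Switching is an involution on pairs: if both switched points were in [S], switching back would
   put [a] and [b] in [S]. *)
apply: idealB => //; apply: mulS => //; apply: contra abS => /andP[cS dS].
have d2' : dist (switch i a b) (switch i b a) = 2.
  rewrite -d2; apply: eq_card => j; rewrite !inE !switchE.
  by case: (eqVneq j i) => [->|]; rewrite // eq_sym.
have d2'' : dist (switch i b a) (switch i a b) = 2 by rewrite dist_sym.
have := swS _ _ cS dS d2' i it; have := swS _ _ dS cS d2'' i it.
by rewrite !switch_switchr !switch_switchl !switchxx => -> ->.
Qed.

Lemma prime_PS P : prime_ideal P -> psubset (Iideal t) P ->
  exists S, switchable t S /\ psubset (PS t S) P.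
Proof.
move=> [idP P1 PP] IP; have [P0 PD PM] := idP.
have genP i a b : dist a b = 2 -> (i < t)%N -> P (fgen F i a b).
  by move=> d2 it; apply: IP => I _; apply; exists i, a, b.
(* Membership in [P] is not decidable, so excluded middle over the finite [N] supplies the boolean
   predicate that defines [S]. *)
have [f fP] : exists f : N -> bool, forall a, f a <-> ~ P (x a).
  apply: (fin_all_exists (P := fun a (u : bool) => u <-> ~ P (x a))) => a.
  by have [Pa|nPa] := classic (P (x a)); [exists false | exists true]; split.
pose S : {set N} := [set a | f a].
have SP a : a \in S <-> ~ P (x a) by rewrite inE.
have cancel a p : a \in S -> P (x a * p) -> P p.
  by move=> /SP nPa /PP[].
exists S; split.
  move=> a b aS bS d2 i it; apply/SP => Pab.
  have /SP nPb := bS; apply: nPb; apply: (cancel a) => //.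
  rewrite -[x a * x b](subrK (x (switch i a b) * x (switch i b a))).
  by apply: PD; [exact: genP | rewrite mulrC; apply: PM].
apply: PS_min => // [a aS|i a b it ab].
  by apply: NNPP => /SP; apply/negP.
have aS := connected_inl ab.
(* [Q c] says that the lines in direction [i] through [a] and [c] are proportional modulo [P], as
   vanishing 2 by 2 minors; [e = a], [e' = b], [c = b] gives [fgen i a b]. *)
pose Q c := forall e e', P (x (switch i a e) * x (switch i c e') -
                           x (switch i a e') * x (switch i c e)).
suff /(_ a b) : Q b by rewrite !switchxx.
apply: (connected_ind (Q := Q) _ ab); last by move=> e e'; rewrite mulrC subrr.
move=> c d cS dS cd Qc e e'.
have [cdi|cdi] := eqVneq (c i) (d i); last by rewrite -!(edge_switch _ cd cdi).
(* The lines through [c] and [d] are proportional with ratio [x c] to [x d], by the generators at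
   distance 2. *)
have profile u : P (x d * x (switch i c u) - x c * x (switch i d u)).
  have [uci|uci] := eqVneq (u i) (c i).
    rewrite (switch_eq (esym uci)) switch_eq -?cdi // mulrC subrr //.
  have [->|ne_cd] := eqVneq c d; first by rewrite subrr.
  rewrite -fgen_switch //; apply: genP => //.
  by apply: edge_dist2; rewrite -?cdi // 1?eq_sym // dist_sym.
(* Since [x c] is not in [P], it suffices to treat the minor multiplied by [x c], where [profile]
   trades [d] for [c]. *)
apply: (cancel c) => //.
have -> : x c * (x (switch i a e) * x (switch i d e') - x (switch i a e') * x (switch i d e)) =
  x d * (x (switch i a e) * x (switch i c e') - x (switch i a e') * x (switch i c e))
  - x (switch i a e) * (x d * x (switch i c e') - x c * x (switch i d e'))
  + x (switch i a e') * (x d * x (switch i c e) - x c * x (switch i d e)) by ring.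
apply: PD; last by apply: PM.
by apply: idealB => //; apply: PM.
Qed.

Lemma PS_sub S T : switchable t S -> psubset (PS (F := F) t T) (PS t S) -> S \subset T.
Proof.
move=> swS TS; apply/subsetP => a; apply: contraTT => /PS_xvar-/(_ F t)/TS.
by rewrite PS_xvarE.
Qed.

End Minimal.

Theorem theorem4p13 (n : nat) (r : 'I_n -> nat) (F : fieldType) (t : nat) :
  (forall i, 0 < r i)%N -> (1 <= t <= n)%N ->
  forall P : pset r F,
    @minimal_prime_over n r F (@Iideal n r F t) P <->
    exists S : {set Nset r},
      @maximal_switchable n r F t S /\ (forall p, P p <-> @PS n r F t S p).
Proof.
move=> _ _ P; split=> [[prP IP minP]|[S [[swS maxS] PS_P]]].
  have [S [swS SP]] := prime_PS prP IP.
  have PS_P : psubset P (PS t S) by exact: minP _ (PS_prime F swS) (Iideal_PS swS) SP.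
  exists S; split; last by move=> p; split; [apply: PS_P|apply: SP].
  split=> // T swT ST; have ST' := proper_subn ST; split=> [/(PS_sub swT)|TS].
    by rewrite (negPf ST').
  (* If [PS t T] lay in [PS t S], minimality of [P] would make the two ideals equal, hence [T] a
     subset of [S]. *)
  have: psubset (PS (F := F) t S) (PS t T).
    move=> p /SP; apply: (minP (PS t T)); [exact: PS_prime|exact: Iideal_PS|].
    by move=> q /TS /SP.
  by move=> /(PS_sub swT); rewrite (negPf ST').
have [[P0 PD PM] P1 PP] := PS_prime F swS.
split.
- split; first split.
  + exact/PS_P.
  + by move=> p q /PS_P Pp /PS_P Pq; apply/PS_P/PD.
  + by move=> p q /PS_P Pq; apply/PS_P/PM.
  + by move=> /PS_P.
  + by move=> p q /PS_P /PP[] /PS_P; auto.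
- by move=> p /(Iideal_PS swS) /PS_P.
move=> Q prQ IQ QP; have [T [swT TQ]] := prime_PS prQ IQ.
have TS : psubset (PS (F := F) t T) (PS t S) by move=> p /TQ /QP /PS_P.
(* Either [S = T], and then [Q] contains [P], or [T] is strictly larger and the inclusion [TS]
   contradicts maximality. *)
have := PS_sub swS TS; rewrite subEproper => /orP[/eqP eST|ST].
  by move=> p /PS_P; rewrite eST; apply: TQ.
by have [] := maxS T swT ST.
Qed.
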